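(* Let $X$ be a Banach space and let $T \in L(X)$. Then $T$ is a B-Fredholm operator if and only if $\pi(T)$ is both left and right Drazin invertible in the algebra $\mathcal{C}_0(X)$.
   Context: $L(X)$ is the Banach algebra of bounded linear operators on the Banach space $X$, $F_0(X)$ is the ideal of finite rank operators in $L(X)$, $\mathcal{C}_0(X) = L(X)/F_0(X)$ is the (purely algebraic) quotient algebra, and $\pi : L(X) \to \mathcal{C}_0(X)$ is the natural projection. For $T \in L(X)$ and a nonnegative integer $n$, $T_{[n]}$ denotes the restriction of $T$ to $R(T^n)$ viewed as a map from $R(T^n)$ into $R(T^n)$ (so $T_{[0]} = T$), where $R(\cdot)$ denotes the range. $T$ is called a B-Fredholm operator if for some integer $n \ge 0$ the range $R(T^n)$ is closed and $T_{[n]}$ is a Fredholm operator (closed range, finite-dimensional null space, range of finite codimension). Let $A$ be a ring with unit, and for $p \in A$ let $comm(p) = \{x \in A : xp = px\}$. For an idempotent $p \in A$, an element $a \in A$ is called left (resp. right) $p$-invertible if $ap = pa$ and $a + p$ is left (resp. right) invertible in $comm(p)$ (i.e. has a left (resp. right) inverse belonging to $comm(p)$). An element $a \in A$ is called left (resp. right) Drazin invertible if there exists an idempotent $p \in A$ such that $a$ is left (resp. right) $p$-invertible and $ap$ is nilpotent. (The idempotents for left and right Drazin invertibility are not required to coincide.) *)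

(* Defs.v *)
From HB Require Import structures.
From mathcomp Require Import all_boot all_order all_algebra.
From mathcomp Require Import generic_quotient ring_quotient.
From mathcomp Require Import boolp classical_sets functions.
From mathcomp Require Import reals topology normedtype.
From mathcomp Require Import complex.

Set Implicit Arguments.
Unset Strict Implicit.
Unset Printing Implicit Defensive.

Import Order.TTheory GRing.Theory Num.Theory.
Import numFieldNormedType.Exports.

Local Open Scope classical_set_scope.
Local Open Scope ring_scope.

Section Drazin.
Variable A : pzRingType.
Implicit Types a p : A.

(* [GRing.comm x p], i.e. x * p = p * x, expresses that x belongs to comm(p). *)
Definition left_pinvertible p a : Prop :=
  GRing.comm a p /\ exists2 b, GRing.comm b p & b * (a + p) = 1.

Definition right_pinvertible p a : Prop :=
  GRing.comm a p /\ exists2 b, GRing.comm b p & (a + p) * b = 1.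

Definition nilpotent_elt a : Prop := exists n, a ^+ n = 0.

Definition left_Drazin_invertible a : Prop :=
  exists p, [/\ p * p = p, left_pinvertible p a & nilpotent_elt (a * p)].

Definition right_Drazin_invertible a : Prop :=
  exists p, [/\ p * p = p, right_pinvertible p a & nilpotent_elt (a * p)].
End Drazin.

Section FiniteDimension.
Variables (K : fieldType) (V : lmodType K).

(* Only the values of [c] below [size s] matter. *)
Definition lin_span (s : seq V) : set V :=
  [set v | exists c : nat -> K, v = \sum_(i < size s) c i *: s`_i].

(* Meant for linear subspaces [M]: [M] has finite dimension iff it lies in the
   span of finitely many vectors, and V / M has finite dimension iff it is
   spanned by the classes of finitely many vectors. *)
Definition finite_dim (M : set V) : Prop := exists s, M `<=` lin_span s.

Definition finite_codim (M : set V) : Prop :=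
  exists s, forall v, exists2 u, lin_span s u & M (v - u).

Lemma lin_span0 (s : seq V) : lin_span s 0.
Proof.
by exists (fun=> 0); rewrite big1 // => i _; rewrite scale0r.
Qed.

Lemma lin_spanN (s : seq V) u : lin_span s u -> lin_span s (- u).
Proof.
move=> [c ->]; exists (fun i => - c i); rewrite -sumrN.
by apply: eq_bigr => i _; rewrite scaleNr.
Qed.

Lemma lin_span_cat (s t : seq V) u v :
  lin_span s u -> lin_span t v -> lin_span (s ++ t) (u + v).
Proof.
move=> [c ->] [d ->].
exists (fun i => if (i < size s)%N then c i else d (i - size s)%N).
rewrite size_cat big_split_ord /=; congr (_ + _); apply: eq_bigr => i _.
  by rewrite ltn_ord nth_cat ltn_ord.
by rewrite nth_cat ltnNge leq_addr /= addKn.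
Qed.

Lemma finite_dim0 : finite_dim [set 0].
Proof. by exists [::] => v ->; exact: lin_span0. Qed.

Lemma finite_dimS (M N : set V) : M `<=` N -> finite_dim N -> finite_dim M.
Proof. by move=> MN [s Ns]; exists s => v /MN /Ns. Qed.
End FiniteDimension.

Lemma finite_dim_linear_image (K : fieldType) (V W : lmodType K)
  (f : V -> W) (M : set V) :
  linear f -> finite_dim M -> finite_dim (f @` M).
Proof.
move=> lf [s Ms]; exists (map f s) => _ [v /Ms [c ->] <-].
pose g : {linear V -> W} := HB.pack f (GRing.isLinear.Build _ _ _ _ _ lf).
exists c; rewrite -[f _]/(g _) raddf_sum size_map.
by apply: eq_bigr => i _; rewrite (nth_map 0) //; exact: (linearZ_LR g).
Qed.

Section BoundedOperators.
Variables (K : numFieldType) (X : normedModType K).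

Definition bounded_linear (f : X -> X) : Prop :=
  linear f /\ exists M : K, forall x, `|f x| <= M * `|x|.

Definition bounded_linear_pred : {pred X -> X} := fun f => `[< bounded_linear f >].

Lemma bounded_linear_submod_closed : submod_closed bounded_linear_pred.
Proof.
split=> [|a f g /asboolP [lf [M fM]] /asboolP [lg [N gN]]]; apply/asboolP.
  split=> [b x y|]; first by rewrite /= scaler0 addr0.
  by exists 0 => x; rewrite normr0 mul0r.
split=> [b x y|].
  rewrite !fctE lf lg !scalerDr !scalerA -!addrA; congr (_ + _).
    by rewrite mulrC.
  by rewrite addrCA.
exists (`|a| * M + N) => x; rewrite !fctE mulrDl.
by rewrite (le_trans (ler_normD _ _))// lerD// normrZ -mulrA ler_wpM2l.
Qed.

HB.instance Definition _ := GRing.isSubmodClosed.Build K (X -> X)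
  bounded_linear_pred bounded_linear_submod_closed.

(* The algebra L(X). *)
Record boundedOp := BoundedOp {
  op_fun :> X -> X;
  op_funP : op_fun \in bounded_linear_pred }.

HB.instance Definition _ := [isSub for op_fun].
HB.instance Definition _ := [Choice of boundedOp by <:].
HB.instance Definition _ := [SubChoice_isSubLmodule of boundedOp by <:].

Lemma op_linear (T : boundedOp) : linear T.
Proof. by case: (asboolP _ (op_funP T)). Qed.

HB.instance Definition _ (T : boundedOp) :=
  GRing.isLinear.Build K X X *:%R (op_fun T) (op_linear T).

Lemma op_bounded (T : boundedOp) : exists M : K, forall x, `|T x| <= M * `|x|.
Proof. by case: (asboolP _ (op_funP T)). Qed.

Lemma op_ext (S T : boundedOp) : S =1 T -> S = T.
Proof. by move=> ST; apply/val_inj/funext. Qed.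

Lemma op_one_subproof : (id : X -> X) \in bounded_linear_pred.
Proof. by apply/asboolP; split=> //; exists 1 => x; rewrite mul1r. Qed.

Definition op_one : boundedOp := BoundedOp op_one_subproof.

Lemma op_mul_subproof (S T : boundedOp) : (S \o T : X -> X) \in bounded_linear_pred.
Proof.
apply/asboolP; split=> [a x y|]; first by rewrite /= !linearP.
have [M SM] := op_bounded S; have [N TN] := op_bounded T.
exists (`|M| * N) => x /=; rewrite -mulrA.
have M_real (y : X) : M * `|y| <= `|M| * `|y|.
  have : 0 <= M * `|y| by exact: le_trans (SM y).
  by move=> /ger0_norm <-; rewrite normrM normr_id.
by apply: le_trans (SM _) (le_trans (M_real _) _); rewrite ler_wpM2l.
Qed.

Definition op_mul (S T : boundedOp) : boundedOp := BoundedOp (op_mul_subproof S T).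

Lemma op_mulA : associative op_mul. Proof. by move=> S T U; exact: op_ext. Qed.
Lemma op_mul1 : left_id op_one op_mul. Proof. by move=> T; exact: op_ext. Qed.
Lemma op_mulr1 : right_id op_one op_mul. Proof. by move=> T; exact: op_ext. Qed.
Lemma op_mulDl : left_distributive op_mul +%R.
Proof. by move=> S T U; exact: op_ext. Qed.
Lemma op_mulDr : right_distributive op_mul +%R.
Proof. by move=> S T U; apply: op_ext => x; exact: linearD. Qed.

HB.instance Definition _ := GRing.Zmodule_isPzRing.Build boundedOp
  op_mulA op_mul1 op_mulr1 op_mulDl op_mulDr.

Lemma opME (S T : boundedOp) x : (S * T) x = S (T x). Proof. by []. Qed.
Lemma opDE (S T : boundedOp) x : (S + T) x = S x + T x. Proof. by []. Qed.
Lemma opNE (T : boundedOp) x : (- T) x = - T x. Proof. by []. Qed.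
Lemma op1E x : (1 : boundedOp) x = x. Proof. by []. Qed.
Lemma op0E x : (0 : boundedOp) x = 0. Proof. by []. Qed.

Definition Fredholm (T : boundedOp) : Prop :=
  [/\ closed (range T), finite_dim [set x | T x = 0] & finite_codim (range T)].

Definition finite_rank : {pred boundedOp} := fun T => `[< finite_dim (range T) >].

Lemma finite_rank_zmod_closed : zmod_closed finite_rank.
Proof.
split=> [|S T /asboolP [s Ss] /asboolP [t Tt]]; apply/asboolP.
  by apply: finite_dimS (@finite_dim0 _ _) => _ [x _ <-].
exists (s ++ t) => _ [x _ <-]; rewrite opDE opNE.
by apply: lin_span_cat; [apply: Ss | apply/lin_spanN/Tt]; exists x.
Qed.

HB.instance Definition _ := GRing.isZmodClosed.Build boundedOp
  finite_rank finite_rank_zmod_closed.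

Lemma finite_rankMl (S T : boundedOp) : T \in finite_rank -> S * T \in finite_rank.
Proof.
move=> /asboolP Tfin; apply/asboolP.
apply: finite_dimS (finite_dim_linear_image (op_linear S) Tfin).
by move=> _ [x _ <-]; exists (T x) => //; exists x.
Qed.

Lemma finite_rankMr (S T : boundedOp) : S \in finite_rank -> S * T \in finite_rank.
Proof.
move=> /asboolP; move=> Sfin; apply/asboolP; apply: finite_dimS Sfin.
by move=> _ [x _ <-]; exists (T x).
Qed.

End BoundedOperators.

Notation "''L' ( X )" := (boundedOp X) (format "''L' ( X )") : type_scope.

Section Calkin.
Variables (K : numFieldType) (X : normedModType K).
Local Open Scope quotient_scope.

(* C_0(X) = L(X) / F_0(X). The library supplies the quotient as an additive
   group; its ring quotients require commutativity and a proper ideal, and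
   F_0(X) = L(X) when X has finite dimension. *)
Definition calkin0 : Type := Quotient.quot (@finite_rank K X).

HB.instance Definition _ := GRing.Zmodule.on calkin0.

Definition calkin0_pi (T : 'L(X)) : calkin0 := \pi_(Quotient.quot (@finite_rank K X)) T.

Lemma calkin0_piP (S T : 'L(X)) :
  calkin0_pi S = calkin0_pi T <-> S - T \in @finite_rank K X.
Proof. by rewrite Quotient.idealrBE; split=> [/eqP|/eqP]. Qed.

Definition calkin0_repr (x : calkin0) : 'L(X) :=
  repr (x : Quotient.quot (@finite_rank K X)).

Lemma calkin0_reprK : cancel calkin0_repr calkin0_pi.
Proof. by move=> x; exact: reprK. Qed.

Definition calkin0_one : calkin0 := calkin0_pi 1.
Definition calkin0_mul (x y : calkin0) : calkin0 :=
  calkin0_pi (calkin0_repr x * calkin0_repr y).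

Lemma calkin0_piD : {morph calkin0_pi : S T / S + T}.
Proof. exact: raddfD. Qed.

Lemma calkin0_piM S T :
  calkin0_mul (calkin0_pi S) (calkin0_pi T) = calkin0_pi (S * T).
Proof.
apply/calkin0_piP; set S' := calkin0_repr _; set T' := calkin0_repr _.
have S'S : S' - S \in @finite_rank K X by apply/calkin0_piP/calkin0_reprK.
have T'T : T' - T \in @finite_rank K X by apply/calkin0_piP/calkin0_reprK.
rewrite -(subrKA (S * T')) -mulrBl -mulrBr.
by apply: rpredD; [exact: finite_rankMr | exact: finite_rankMl].
Qed.

Lemma calkin0_ind (P : calkin0 -> Prop) :
  (forall T, P (calkin0_pi T)) -> forall x, P x.
Proof. by move=> PT x; rewrite -(calkin0_reprK x). Qed.

Lemma calkin0_mulA : associative calkin0_mul.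
Proof.
move=> x y z; elim/calkin0_ind: x => S; elim/calkin0_ind: y => T.
elim/calkin0_ind: z => U.
by rewrite !calkin0_piM mulrA.
Qed.

Lemma calkin0_mul1 : left_id calkin0_one calkin0_mul.
Proof. by move=> x; elim/calkin0_ind: x => T; rewrite calkin0_piM mul1r. Qed.

Lemma calkin0_mulr1 : right_id calkin0_one calkin0_mul.
Proof. by move=> x; elim/calkin0_ind: x => T; rewrite calkin0_piM mulr1. Qed.

Lemma calkin0_mulDl : left_distributive calkin0_mul +%R.
Proof.
move=> x y z; elim/calkin0_ind: x => S; elim/calkin0_ind: y => T.
elim/calkin0_ind: z => U.
by rewrite -calkin0_piD !calkin0_piM mulrDl calkin0_piD.
Qed.

Lemma calkin0_mulDr : right_distributive calkin0_mul +%R.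
Proof.
move=> x y z; elim/calkin0_ind: x => S; elim/calkin0_ind: y => T.
elim/calkin0_ind: z => U.
by rewrite -calkin0_piD !calkin0_piM mulrDr calkin0_piD.
Qed.

HB.instance Definition _ := GRing.Zmodule_isPzRing.Build calkin0
  calkin0_mulA calkin0_mul1 calkin0_mulr1 calkin0_mulDl calkin0_mulDr.

Lemma calkin0_pi_zmod_morphism : zmod_morphism calkin0_pi.
Proof. exact: raddfB. Qed.

Lemma calkin0_pi_monoid_morphism : monoid_morphism calkin0_pi.
Proof. by split=> // S T; rewrite -calkin0_piM. Qed.

HB.instance Definition _ := GRing.isZmodMorphism.Build 'L(X) calkin0
  calkin0_pi calkin0_pi_zmod_morphism.
HB.instance Definition _ := GRing.isMonoidMorphism.Build 'L(X) calkin0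
  calkin0_pi calkin0_pi_monoid_morphism.

End Calkin.

(* The range of T as a normed space, with the norm of X. *)
Section RangeSpace.
Variables (K : numFieldType) (X : normedModType K) (T : 'L(X)).

Definition range_pred : {pred X} := fun x => `[< range T x >].

Lemma range_submod_closed : submod_closed range_pred.
Proof.
split=> [|a x y /asboolP [u _ <-] /asboolP [v _ <-]]; apply/asboolP.
  by exists 0 => //; rewrite linear0.
by exists (a *: u + v) => //; rewrite linearP.
Qed.

HB.instance Definition _ := GRing.isSubmodClosed.Build K X
  range_pred range_submod_closed.

Record rangeSpace := RangeSpace {
  range_val :> X;
  range_valP : range_val \in range_pred }.

HB.instance Definition _ := [isSub for range_val].
HB.instance Definition _ := [Choice of rangeSpace by <:].
HB.instance Definition _ := [SubChoice_isSubLmodule of rangeSpace by <:].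

Definition range_norm (x : rangeSpace) : K := `|range_val x|.

Lemma range_normD x y : range_norm (x + y) <= range_norm x + range_norm y.
Proof. exact: ler_normD. Qed.

Lemma range_normZ a x : range_norm (a *: x) = `|a| * range_norm x.
Proof. exact: normrZ. Qed.

Lemma range_norm0_eq0 x : range_norm x = 0 -> x = 0.
Proof. by move=> /eqP; rewrite normr_eq0 => /eqP x0; exact/val_inj. Qed.

HB.instance Definition _ := Lmodule_isNormed.Build K rangeSpace
  range_normD range_normZ range_norm0_eq0.
End RangeSpace.

Section BFredholm.
Variables (K : numFieldType) (X : normedModType K).

Lemma range_restr_subproof (T : 'L(X)) n (x : rangeSpace (T ^+ n)) :
  T x \in range_pred (T ^+ n).
Proof.
case: x => x /= /asboolP [y _ <-]; apply/asboolP; exists (T y) => //.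
by rewrite -!opME -exprS -exprSr.
Qed.

Definition range_restr_fun (T : 'L(X)) n (x : rangeSpace (T ^+ n)) :
  rangeSpace (T ^+ n) := RangeSpace (range_restr_subproof x).

Lemma range_restr_bounded (T : 'L(X)) n :
  @range_restr_fun T n \in @bounded_linear_pred K (rangeSpace (T ^+ n)).
Proof.
apply/asboolP; split=> [a x y|]; first by apply: val_inj; exact: linearP.
by have [M TM] := op_bounded T; exists M => x; exact: TM.
Qed.

(* T_[n] *)
Definition range_restr (T : 'L(X)) n : 'L(rangeSpace (T ^+ n)) :=
  BoundedOp (range_restr_bounded T n).

Definition B_Fredholm (T : 'L(X)) : Prop :=
  exists2 n, closed (range (T ^+ n)) & Fredholm (range_restr T n).
End BFredholm.

(* Main.v *)
Require Import Defs.
From HB Require Import structures.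
From mathcomp Require Import all_boot all_order all_algebra.
From mathcomp Require Import boolp classical_sets functions.
From mathcomp Require Import ring lra.
From mathcomp Require Import reals topology normedtype complex.

(** Write t for the class of T in the algebra of operators modulo finite rank.

    Suppose that t is left and right Drazin invertible, possibly with different
    idempotents.  Then for large N the power t^N is regular and belongs both to
    the left ideal and to the right ideal generated by t^(N + 1)
    ([left_Drazin_regular], [right_Drazin_regular]).  Regularity modulo finite rank
    exhibits the range of T^N as the kernel of a bounded operator, so it is closed
    ([regular_closed_range]).  The two ideal memberships, lifted to operators, say
    that T_[N] has finite-dimensional kernel and range of finite codimension
    ([Drazin_B_Fredholm]).

    Conversely, let Y be the closed range of T^n and let A = T_[n] be Fredholm on Y.
    As Y is complete, A has a parametrix G, that is, an inverse modulo finite rank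
    ([Fredholm_parametrix]).  The operator S = G^(n + 1) T^n, viewed from X to X,
    satisfies T S = G^n T^n = S T, S T S = S and T^(n + 1) S = T^n modulo finite rank
    ([B_Fredholm_Drazin]).  So the class s of S is a Drazin inverse of t, which makes t left
    and right Drazin invertible for the idempotent 1 - t s
    ([Drazin_inverse_invertible]).

    The analysis needed is the Hahn-Banach theorem, to project onto
    finite-dimensional subspaces and onto closed subspaces of finite codimension,
    and the open mapping theorem, to bound the parametrix.  Both are proved for
    real scalars ([hahn_banach], [open_onto_range]) and carried over to complex
    spaces by restricting scalars.  Everything else is done over a field of scalars
    K for which these two theorems and the archimedean property hold. *)

Set Implicit Arguments.
Unset Strict Implicit.
Unset Printing Implicit Defensive.
Import Order.TTheory GRing.Theory Num.Theory.
Import numFieldNormedType.Exports.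

Local Open Scope classical_set_scope.
Local Open Scope ring_scope.
Local Open Scope complex_scope.

(** * One-sided Drazin invertibility in rings *)

Section DrazinRing.
Variable A : pzRingType.
Implicit Types a b p s : A.

(** On the corner cut out by [1 - p] the summand [p] is invisible, so one-sided
    inverses of [a + p] act there as one-sided inverses of [a]. *)
Lemma expr_add_idem a p i : GRing.comm a p -> p * p = p ->
  (a + p) ^+ i * (1 - p) = a ^+ i * (1 - p).
Proof.
move=> ap pp; elim: i => [|i IH]; first by rewrite !expr0.
have apq : GRing.comm a (1 - p) by apply: commrB; first exact: commr1.
rewrite !exprSr -!mulrA mulrDl mulrBr mulr1 [p * _]mulrBr mulr1 pp subrr addr0.
by rewrite -[X in a - X]/(a * p) -[X in X - _](mulr1 a) -mulrBr apq !mulrA IH.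
Qed.

Lemma expr_linv a b i : b * a = 1 -> b ^+ i * a ^+ i = 1.
Proof.
move=> ba; elim: i => [|i IH]; first by rewrite !expr0 mul1r.
by rewrite exprSr exprS -mulrA (mulrA b) ba mul1r.
Qed.

(** Since [p] is idempotent and commutes with [a], nilpotency of [a * p] means
    that high powers of [a] live in the corner of [1 - p]. *)
Lemma nilpotent_idem a p : GRing.comm a p -> p * p = p ->
  nilpotent_elt (a * p) ->
  exists k, forall j, (k <= j)%N -> a ^+ j * (1 - p) = a ^+ j.
Proof.
move=> ap pp [k apk]; exists k => j kj.
have pk i : p ^+ i * p = p by elim: i => [|i IH]; rewrite ?mul1r // exprS -mulrA IH.
rewrite mulrBr mulr1 -(subnK kj) exprD -mulrA -[X in _ * (_ * X)](pk k).
by rewrite [a ^+ k * _]mulrA -exprMn_comm // apk mul0r mulr0 subr0.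
Qed.

(** The inverse [b] of [a + p] satisfies b^i a^i (1 - p) = 1 - p, and 1 - p fixes
    a^j for large j.  The exponents i and j are independent: [i = j] makes a^j
    von Neumann regular, [i = j + 1] puts a^j in the left ideal of a^(j + 1). *)
Lemma left_Drazin_regular a : left_Drazin_invertible a ->
  exists b k, forall i j, (k <= j)%N -> a ^+ j * b ^+ i * a ^+ i = a ^+ j.
Proof.
move=> [p [pp [ap [b bp bap]] /(nilpotent_idem ap pp) [k ajq]]].
exists b, k => i j /ajq {}ajq.
have aq n : GRing.comm (1 - p) (a ^+ n).
  by apply/commrX/commr_sym/commrB => //; exact: commr1.
rewrite -[in LHS]ajq -!mulrA [_ * (b ^+ i * _)]mulrA.
have -> : (1 - p) * b ^+ i = b ^+ i * (1 - p).
  by apply: commrX; apply/commr_sym/commrB => //; exact: commr1.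
rewrite -!mulrA aq -(expr_add_idem i ap pp) [b ^+ i * _]mulrA expr_linv //.
by rewrite mul1r.
Qed.

Lemma right_Drazin_regular a : right_Drazin_invertible a ->
  exists b k, forall i j, (k <= j)%N -> a ^+ i * b ^+ i * a ^+ j = a ^+ j.
Proof.
move=> [p [pp [ap [b bp abp]] /(nilpotent_idem ap pp) [k ajq]]].
exists b, k => i j /ajq {}ajq.
have comm_q c n : GRing.comm c p -> GRing.comm (c ^+ n) (1 - p).
  by move=> cp; apply/commr_sym/commrX/commr_sym/commrB => //; exact: commr1.
have {}ajq : (1 - p) * a ^+ j = a ^+ j by rewrite -comm_q.
have abq : a ^+ i * b ^+ i * (1 - p) = 1 - p.
  rewrite -mulrA comm_q // mulrA -expr_add_idem // -mulrA -comm_q //.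
  by rewrite mulrA expr_linv // mul1r.
by rewrite -[in LHS]ajq mulrA abq ajq.
Qed.

(** A genuine Drazin inverse [s] gives the idempotent 1 - a s for both sides.  On
    its corner [a] is nilpotent, so [a + p] is inverted there by the finite
    geometric series [c]; on the complementary corner it is inverted by [s]. *)
Lemma Drazin_inverse_invertible a s n :
  a * s = s * a -> s * a * s = s -> a ^+ n.+1 * s = a ^+ n ->
  left_Drazin_invertible a /\ right_Drazin_invertible a.
Proof.
move=> as_sa sas ans; pose p := 1 - a * s.
have ap : GRing.comm a p.
  by apply: commrB; [exact: commr1 | apply: commrM; [exact: commr_refl|]].
have ps : p * s = 0 by rewrite /p mulrBl mul1r as_sa sas subrr.
have sp : s * p = 0 by rewrite /p mulrBr mulr1 mulrA sas subrr.
have pp : p * p = p by rewrite {2}/p mulrBr mulr1 as_sa mulrA ps mul0r subr0.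
have anp : a ^+ n.+1 * p = 0.
  by rewrite /p mulrBr mulr1 mulrA -exprSr exprS -mulrA ans -exprS subrr.
have pas : p + a * s = 1 by rewrite /p subrK.
clearbody p; pose c := \sum_(i < n.+1) (- a) ^+ i.
have ac : (1 + a) * c = 1 - (- a) ^+ n.+1.
  by rewrite -[in RHS]opprB subrX1 -mulNr opprB opprK.
have cp : GRing.comm c p.
  apply/commr_sym/commr_sum => i _; apply: commrX.
  by apply/commr_sym/commr_sym/commrN/commr_sym.
have ca : GRing.comm c a.
  apply/commr_sym/commr_sum => i _; apply/commrX/commrN; exact: commr_refl.
have anp' : (- a) ^+ n.+1 * p = 0.
  by rewrite exprNn -mulrA anp mulr0.
clearbody c; pose b := s + c * p.
have bp : GRing.comm b p.
  rewrite /GRing.comm /b mulrDl mulrDr sp ps -mulrA pp !add0r.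
  by rewrite [RHS]mulrA -cp -mulrA pp.
have apb : (a + p) * b = 1.
  rewrite /b mulrDr [_ * s]mulrDl ps addr0 cp mulrA [(a + p) * p]mulrDl pp ap.
  rewrite -[X in p * a + X]mulr1 -mulrDr -mulrA [a + 1]addrC ac mulrBr mulr1.
  have -> : p * (- a) ^+ n.+1 = 0.
    rewrite -[RHS]anp'; apply/commrX/commrN; exact: commr_sym.
  by rewrite subr0 addrC.
have bap : b * (a + p) = 1.
  rewrite -apb; apply: commrD => //; apply/commr_sym/commrD => //.
  by apply: commrM => //; exact: commr_sym.
have nil : nilpotent_elt (a * p).
  by exists n.+1; rewrite exprMn_comm // [p ^+ _]exprS mulrA anp mul0r.
split; exists p; split=> //; split=> //; exists b => //.
Qed.
End DrazinRing.

(** * Spans and finite dimension *)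

Section FiniteDimensionTheory.
Variables (K : fieldType) (V : lmodType K).
Implicit Types s : seq V.

Lemma lin_spanP s a (u v : V) : lin_span s u -> lin_span s v -> lin_span s (a *: u + v).
Proof.
move=> [c ->] [d ->]; exists (fun i => a * c i + d i).
rewrite scaler_sumr -big_split /=; apply: eq_bigr => i _.
by rewrite scalerA scalerDl.
Qed.

Lemma lin_span_nil (v : V) : lin_span [::] v -> v = 0.
Proof. by move=> [c ->]; rewrite big_ord0. Qed.

Lemma lin_span_cons (w : V) s (v : V) :
  lin_span (w :: s) v <-> exists c, lin_span s (v - c *: w).
Proof.
split=> [[c ->]|[c [d dv]]].
  exists (c 0%N); exists (c \o S); rewrite big_ord_recl /= addrC addKr.
  by apply: eq_bigr => i _.
exists (fun i => if i is j.+1 then d j else c).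
by rewrite -(subrK (c *: w) v) dv big_ord_recl /= addrC.
Qed.

Lemma finite_dim_span s : finite_dim (lin_span s).
Proof. by exists s. Qed.
End FiniteDimensionTheory.

Lemma lin_span_map (K : fieldType) (V W : lmodType K) (h : {linear V -> W})
    (s : seq V) u :
  lin_span s u -> lin_span (map h s) (h u).
Proof.
move=> [c ->]; exists c; rewrite raddf_sum size_map.
by apply: eq_bigr => i _; rewrite (nth_map 0) //; exact: (linearZ_LR h).
Qed.

(** Induction on a spanning sequence of [M]: if deleting [w] loses something from
    the preimage, a lost vector [x0] can be used to eliminate the [w]-coordinate. *)
Lemma finite_dim_preimage (K : fieldType) (V W : lmodType K)
    (f : {linear V -> W}) (M : set W) :
  finite_dim [set x | f x = 0] -> finite_dim M -> finite_dim (f @^-1` M).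
Proof.
move=> kerf [s Ms]; apply: (@finite_dimS _ _ _ (f @^-1` lin_span s)).
  by move=> x /Ms.
elim: s {M Ms} => [|w s [t st]].
  by apply: finite_dimS kerf => x /lin_span_nil.
have [s_w|] := pselect (f @^-1` lin_span (w :: s) `<=` f @^-1` lin_span s).
  by exists t => x /s_w /st.
move=> /existsNP[x0 /not_implyP[/lin_span_cons[c0 sx0] nsx0]].
have c0_neq0 : c0 != 0.
  by apply: contra_notN nsx0 => /eqP c00; move: sx0; rewrite c00 scale0r subr0.
exists (x0 :: t) => x /lin_span_cons [c sx]; apply/lin_span_cons.
exists (c / c0); apply: st; rewrite /= linearB linearZ /=.
have -> : f x - (c / c0) *: f x0 =
    - (c / c0) *: (f x0 - c0 *: w) + (f x - c *: w).
  rewrite scalerBr scalerA mulNr mulfVK // !scaleNr opprK.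
  by rewrite [RHS]addrACA subrr addr0 addrC.
exact: lin_spanP.
Qed.

(** * The Hahn-Banach theorem for sublinear functionals *)

Section HahnBanach.
Variables (R : realType) (V : lmodType R).
Implicit Types (p q : V -> R) (x y v : V).

Definition sublinear q :=
  (forall x y, q (x + y) <= q x + q y) /\
  (forall t x, 0 <= t -> q (t *: x) <= t * q x).

Lemma sublinear0 q : sublinear q -> q 0 = 0.
Proof.
move=> [qD qZ]; apply/eqP; rewrite eq_le; apply/andP; split.
  by have := qZ 0 0 (lexx 0); rewrite scale0r mul0r.
by have := qD 0 0; rewrite addr0; lra.
Qed.

Lemma sublinear_oppr q x : sublinear q -> - q (- x) <= q x.
Proof.
by move=> sq; have := sq.1 x (- x); rewrite subrr (sublinear0 sq); lra.
Qed.

(** The lower envelope of [q] along the ray spanned by [v]: a sublinear minorant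
    of [q] whose value at [- v] is at most [- q v].  A minimal sublinear [q]
    therefore satisfies q (- v) = - q v for every v. *)
Definition tilt q v x : R := inf [set q (x + t *: v) - t * q v | t in [set t | 0 <= t]].

Lemma tilt_le q v x t : sublinear q -> 0 <= t ->
  tilt q v x <= q (x + t *: v) - t * q v.
Proof.
move=> sq t0; apply: ge_inf; last by exists t.
exists (- q (- x)) => _ [s /= s0 <-].
have := sq.1 (x + s *: v) (- x); rewrite addrAC subrr add0r => qsv.
have [->|s_neq0] := eqVneq s 0.
  by rewrite scale0r addr0 mul0r subr0; exact: sublinear_oppr.
have : s * q v <= q (s *: v).
  have := sq.2 (s^-1) (s *: v); rewrite invr_ge0 => /(_ s0).
  rewrite scalerA mulVf // scale1r mulrC ler_pdivlMr ?lt0r ?s_neq0 //.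
  by rewrite mulrC.
lra.
Qed.

Lemma le_tilt q v x c : (forall t, 0 <= t -> c <= q (x + t *: v) - t * q v) ->
  c <= tilt q v x.
Proof.
move=> cq; apply: lb_le_inf; first by eexists; exists 0 => //=.
by move=> _ [t t0 <-]; exact: cq.
Qed.

Lemma sublinear_tilt q v : sublinear q -> sublinear (tilt q v).
Proof.
move=> sq; split=> [x y|a x].
  rewrite -lerBlDr; apply: le_tilt => t t0.
  rewrite lerBlDr -lerBlDl; apply: le_tilt => s s0.
  rewrite lerBlDl (le_trans (tilt_le _ _ sq (addr_ge0 t0 s0))) //.
  have := sq.1 (x + t *: v) (y + s *: v).
  by rewrite addrACA -scalerDl; lra.
rewrite le_eqVlt => /predU1P[<-|a0].
  rewrite scale0r mul0r (le_trans (tilt_le _ _ sq (lexx 0))) //.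
  by rewrite scale0r addr0 mul0r subr0 sublinear0.
rewrite -ler_pdivrMl //; apply: le_tilt => t t0; rewrite ler_pdivrMl //.
have at0 : 0 <= a * t by rewrite mulr_ge0 // ltW.
rewrite (le_trans (tilt_le _ _ sq at0)) // -scalerA -scalerDr.
by rewrite mulrBr mulrA lerD2r sq.2 // ltW.
Qed.

(** Zorn's lemma on the sublinear minorants of [p]; the pointwise infimum of a
    chain is again one, being bounded below by [- p (- x)]. *)
Lemma sublinear_minimal p : sublinear p ->
  exists q, [/\ sublinear q, forall x, q x <= p x &
    forall q', sublinear q' -> (forall x, q' x <= q x) -> q' = q].
Proof.
move=> sp.
pose T := {q | sublinear q /\ forall x, q x <= p x}.
pose le (s t : T) := `[< forall x, sval t x <= sval s x >].
have [|||A totA|[q [sq qp]] qmin] := @Zorn T le.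
- by move=> t; apply/asboolP => x.
- move=> r s t /asboolP rs /asboolP st; apply/asboolP => x.
  exact: le_trans (rs x).
- move=> [s Hs] [t Ht] /asboolP /= st /asboolP /= ts; apply: eq_exist.
  by apply/funext => x; apply/eqP; rewrite eq_le st ts.
- have [[q0 Aq0]|A0] := pselect (A !=set0); last first.
    exists (exist _ p (conj sp (fun x => lexx (p x)))) => s As.
    by case: A0; exists s.
  pose g x := inf [set sval q x | q in A].
  have g_le x (q : T) : A q -> g x <= sval q x.
    move=> Aq; apply: ge_inf; last by exists q.
    exists (- p (- x)) => _ [r _ <-].
    case: (svalP r) => sr rp; rewrite lerNl (le_trans _ (rp _)) //.
    by rewrite lerNl sublinear_oppr.
  have le_g x c : (forall q : T, A q -> c <= sval q x) -> c <= g x.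
    move=> cq; apply: lb_le_inf; first by eexists; exists q0.
    by move=> _ [r Ar <-]; exact: cq.
  have sg : sublinear g.
    split=> [x y|t x t0].
      rewrite -lerBlDr; apply: (le_g) => r Ar.
      rewrite lerBlDr -lerBlDl; apply: (le_g) => s As.
      rewrite lerBlDl.
      case: (totA r s Ar As) => /asboolP rs.
        rewrite (le_trans (g_le _ _ As)) // (le_trans ((svalP s).1.1 _ _)) //.
        by rewrite lerD2r rs.
      rewrite (le_trans (g_le _ _ Ar)) // (le_trans ((svalP r).1.1 _ _)) //.
      by rewrite lerD2l rs.
    move: t0; rewrite le_eqVlt => /predU1P[<-|t0].
      rewrite scale0r mul0r (le_trans (g_le _ _ Aq0)) //.
      by rewrite (sublinear0 (svalP q0).1).
    rewrite -ler_pdivrMl //; apply: (le_g) => r Ar; rewrite ler_pdivrMl //.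
    by rewrite (le_trans (g_le _ _ Ar)) // (svalP r).1.2 // ltW.
  have gp x : g x <= p x by rewrite (le_trans (g_le _ _ Aq0)) // (svalP q0).2.
  exists (exist _ g (conj sg gp)) => s As; apply/asboolP => x /=; exact: g_le.
exists q; split=> // q' sq' q'q.
have q'p x : q' x <= p x by exact: le_trans (qp x).
by apply: (congr1 sval (qmin (exist _ q' (conj sq' q'p)) _)); apply/asboolP.
Qed.

(** A minimal sublinear functional coincides with all its tilts, hence is odd,
    hence linear.  Starting from the tilt of [p] in the direction [v] forces the
    value at [v] to be [p v]. *)
Lemma hahn_banach p v : sublinear p ->
  exists f : V -> R, [/\ scalar f, forall x, f x <= p x & f v = p v].
Proof.
move=> sp; have [f [sf fp fmin]] := sublinear_minimal (sublinear_tilt v sp).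
have tilt0 q w x : sublinear q -> tilt q w x <= q x.
  move=> sq; rewrite (le_trans (tilt_le _ _ sq (lexx 0))) //.
  by rewrite scale0r addr0 mul0r subr0.
have tiltN q w : sublinear q -> tilt q w (- w) <= - q w.
  move=> sq; rewrite (le_trans (tilt_le _ _ sq ler01)) //.
  by rewrite scale1r addNr mul1r (sublinear0 sq) sub0r.
have fN x : f (- x) = - f x.
  have := sublinear_oppr (- x) sf; rewrite opprK.
  have := tiltN f x sf; rewrite (fmin _ (sublinear_tilt x sf)); first lra.
  by move=> y; exact: tilt0.
have fD x y : f (x + y) = f x + f y.
  have := sf.1 x y; have := sf.1 (- x) (- y); rewrite -opprD !fN; lra.
have fZ_ge0 t x : 0 <= t -> f (t *: x) = t * f x.
  move=> t0; have := sf.2 t x t0; have := sf.2 t (- x) t0.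
  by rewrite scalerN !fN mulrN; lra.
exists f; split=> [a x y|x|].
- rewrite fD; congr (_ + _); have [a0|a0] := leP 0 a; first exact: fZ_ge0.
  rewrite -[a in LHS]opprK scaleNr fN fZ_ge0 ?oppr_ge0 ?ltW //.
  by rewrite mulNr opprK.
- exact: le_trans (tilt0 _ _ _ sp).
- have := le_trans (fp v) (tilt0 _ v v sp).
  have := le_trans (fp (- v)) (tiltN _ v sp).
  by rewrite fN; lra.
Qed.
End HahnBanach.

(** * Separation and completeness *)

Section SequentialCompleteness.
Variables (K : numFieldType) (V : normedModType K).

Definition subspace (M : set V) : Prop :=
  M 0 /\ forall a x y, M x -> M y -> M (a *: x + y).

(** Completeness tested on sequences with geometrically small steps only; the
    bound on the distance to the limit is the tail of the geometric series. *)
Definition fast_complete (M : set V) : Prop :=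
  forall u : nat -> V, (forall n, M (u n)) ->
    (forall n, `|u n.+1 - u n| <= 2 ^- n) ->
  exists2 l, M l & forall n, `|u n - l| <= 2 * 2 ^- n.
End SequentialCompleteness.

(** The form of the Hahn-Banach theorem used below: a point at positive distance
    from a subspace is separated from it by a continuous functional. *)
Definition separation_property (K : numFieldType) : Prop :=
  forall (V : normedModType K) (M : set V) (v : V) (d : K),
    subspace M -> 0 < d -> (forall m, M m -> d <= `|v - m|) ->
  exists f : V -> K, [/\ scalar f, exists C, forall x, `|f x| <= C * `|x|,
    forall m, M m -> f m = 0 & f v = 1].

(** The open mapping theorem for an operator with complete range, as a bound on
    the norm of some preimage. *)
Definition open_mapping_property (K : numFieldType) : Prop :=
  forall (V W : normedModType K) (A : V -> W),
    linear A -> (exists C, forall x, `|A x| <= C * `|x|) ->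
    fast_complete [set: V] -> fast_complete (range A) ->
  exists C, forall x, exists2 x', A x' = A x & `|x'| <= C * `|A x|.

Definition archimedean_property (K : numFieldType) : Prop :=
  forall e : K, 0 < e -> exists n, 2 ^- n < e.

Section RealScalars.
Variable R : realType.

Lemma real_archimedean : archimedean_property R.
Proof.
move=> e e0; exists (Num.bound e^-1).
rewrite invf_plt ?posrE ?exprn_gt0 //.
have /archi_boundP/lt_le_trans -> // : 0 <= e^-1 by rewrite invr_ge0 ltW.
by rewrite -natrX ler_nat ltnW // ltn_expl.
Qed.

Lemma le_pow2_le0 (a c : R) : (forall n, a <= c * 2 ^- n) -> a <= 0.
Proof.
move=> ac; rewrite leNgt; apply/negP => a0.
have c0 : 0 < c by have := ac 0%N; rewrite expr0 invr1; lra.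
have [n] := real_archimedean (divr_gt0 a0 c0).
by rewrite ltr_pdivlMr // mulrC ltNge ac.
Qed.

(** Hahn-Banach for the distance to [M], which is sublinear, vanishes on [M] and
    is at least [d] at [v]. *)
Lemma real_separation : separation_property R.
Proof.
move=> V M v d [M0 Mlin] d0 dM.
pose p x := inf [set `|x - m| | m in M].
have p_le x m : M m -> p x <= `|x - m|.
  by move=> Mm; apply: ge_inf; [exists 0 => _ [? _ <-] | exists m].
have le_p x c : (forall m, M m -> c <= `|x - m|) -> c <= p x.
  move=> cm; apply: lb_le_inf; first by eexists; exists 0.
  by move=> _ [m Mm <-]; exact: cm.
have sp : sublinear p.
  split=> [x y|t x].
    rewrite -lerBlDr; apply: (le_p) => m Mm.
    rewrite lerBlDr -lerBlDl; apply: (le_p) => n Mn.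
    rewrite lerBlDl; have Mmn : M (m + n) by rewrite -[m]scale1r; exact: Mlin.
    rewrite (le_trans (p_le _ _ Mmn)) // opprD addrACA.
    exact: ler_normD.
  rewrite le_eqVlt => /predU1P[<-|t0].
    by rewrite scale0r mul0r (le_trans (p_le _ _ M0)) // subrr normr0.
  rewrite -ler_pdivrMl //; apply: (le_p) => m Mm; rewrite ler_pdivrMl //.
  have Mtm : M (t *: m) by rewrite -[_ *: _]addr0; exact: Mlin.
  by rewrite (le_trans (p_le _ _ Mtm)) // -scalerBr normrZ gtr0_norm.
have [f [lf fp fv]] := hahn_banach v sp.
have f0 : f 0 = 0 by have := lf (-1) 0 0; rewrite scaler0 addr0 mulN1r addNr.
have fN x : f (- x) = - f x.
  by have := lf (-1) x 0; rewrite !addr0 scaleN1r mulN1r f0 addr0.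
have px x : p x <= `|x| by have := p_le x 0 M0; rewrite subr0.
have pM m : M m -> p m <= 0 by move=> /(p_le m); rewrite subrr normr0.
have fv0 : 0 < f v by rewrite fv (lt_le_trans d0) //; exact: le_p.
exists (fun x => f x / f v); split=> [a x y||m Mm|].
- by rewrite lf mulrDl mulrA.
- exists (f v)^-1 => x; rewrite normrM normfV [`|f v|]gtr0_norm // mulrC.
  rewrite ler_pM2l ?invr_gt0 // ler_norml (le_trans (fp x)) // andbT.
  by rewrite lerNl -fN (le_trans (fp _)) // -[leRHS]normrN px.
- have MN : M (- m) by rewrite -[- m]addr0 -scaleN1r; exact: Mlin.
  have := le_trans (fp _) (pM _ MN); have := le_trans (fp _) (pM _ Mm).
  rewrite fN => fm fNm; have -> : f m = 0 by lra.
  by rewrite mul0r.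
- by rewrite divff // gt_eqF.
Qed.
End RealScalars.

(** * The open mapping theorem over the reals *)

Section RealOpenMapping.
Variables (R : realType) (V W : normedModType R) (A : {linear V -> W}).
Hypothesis completeA : fast_complete (range A).

(** Baire's argument.  Otherwise every ball of the range contains a smaller ball
    that keeps away from the image of the ball of radius [n]; nesting these balls
    for all [n] yields a limit in the range with no preimage. *)
Lemma image_ball_somewhere_dense : exists n z0 r, [/\ 0 < r, range A z0 &
  forall z e, range A z -> `|z - z0| < r -> 0 < e ->
    exists2 x, `|x| <= n%:R & `|z - A x| < e].
Proof.
apply: contrapT => nowhere.
(* Pairs of a centre in the range and a radius.  The factor 2 below leaves room
   for the limit of the centres, which is only in the closed balls. *)
pose good (p : W * R) := range A p.1 /\ 0 < p.2.
have next (a : nat * (W * R)) : exists q : W * R, good a.2 ->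
    [/\ good q, `|q.1 - a.2.1| <= a.2.2 - q.2, q.2 <= a.2.2 / 2 &
      forall x, `|x| <= a.1%:R -> 2 * q.2 <= `|q.1 - A x|].
  have [[Ma2 r0]|na] := pselect (good a.2); last by exists (0, 0).
  case: a => n [z r] /= in Ma2 r0 *.
  apply: contrapT => /forallNP nq; apply: nowhere; exists n, z, (r / 2).
  split=> // [|z' e Mz' z'z e0]; first by lra.
  apply: contrapT => nx; pose r' := Num.min (r / 2) (e / 2).
  have [r'0 r'r r'e] : [/\ 0 < r', r' <= r / 2 & r' <= e / 2].
    by split; rewrite /r' ?lt_min ?ge_min ?lexx ?orbT //; apply/andP; split; lra.
  apply: (nq (z', r')) => _; split=> //=; first by lra.
  move=> x xn; rewrite leNgt; apply/negP => xe; apply: nx; exists x => //.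
  lra.
have [F FP] := choice next.
pose s := fix s n := if n is m.+1 then F (m, s m) else (0 : W, 1 : R).
have sP n : good (s n).
  elim: n => [|n /(FP (n, s n))[]//].
  by split=> //=; exists 0 => //; rewrite linear0.
have sS n := FP (n, s n) (sP n).
have r_le n : (s n).2 <= 2 ^- n.
  elim: n => [|n IH]; first by rewrite expr0 invr1.
  have [_ _ /= le2 _] := sS n; rewrite (le_trans le2) // exprS invfM mulrC.
  by rewrite ler_pM2l ?invr_gt0.
have r_gt0 n : 0 < (s n).2 := (sP n).2.
have [l Ml ls] : exists2 l, range A l & forall n, `|(s n).1 - l| <= 2 * 2 ^- n.
  apply: completeA => n; first exact: (sP n).1.
  have [_ /= le1 _ _] := sS n; have := r_le n; have := r_gt0 n.+1; lra.
have dist_s n k : `|(s (n + k)%N).1 - (s n).1| <= (s n).2 - (s (n + k)%N).2.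
  elim: k => [|k IH]; first by rewrite addn0 !subrr normr0.
  rewrite addnS; have [_ /= le1 _ _] := sS (n + k)%N.
  have := ler_distD (s (n + k)%N).1 (s (n + k).+1).1 (s n).1.
  rewrite /= in IH le1 *; lra.
have dist_l n : `|(s n).1 - l| <= (s n).2.
  rewrite -subr_le0; apply: (@le_pow2_le0 _ _ 2) => k.
  have le_nk : 2 ^- (n + k) <= 2 ^- k :> R.
    by rewrite lef_pV2 ?posrE ?exprn_gt0 // ler_eXn2l ?ltr1n // leq_addl.
  have := ls (n + k)%N; have := dist_s n k; have := r_gt0 (n + k)%N.
  have := ler_distD (s (n + k)%N).1 (s n).1 l.
  by rewrite [X in _ <= X + _]distrC; lra.
have [x _ xl] := Ml; pose n := Num.bound `|x|.
(* The preimage x of the limit lies in the ball of radius n, whose image is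
   avoided by the ball with index n + 1. *)
have xn : `|x| <= n%:R by rewrite ltW // archi_boundP.
have [_ _ _ /(_ x xn)/=] := sS n.
have := dist_l n.+1; have := r_gt0 n.+1; rewrite /= xl; lra.
Qed.

(** Differences of two approximate preimages, of points near [z0], approximate
    preimages of points near 0; then rescale. *)
Lemma almost_open : exists2 C, 0 < C & forall z e, range A z -> 0 < e ->
  exists2 x, `|x| <= C * `|z| & `|z - A x| < e.
Proof.
have [n [z0 [r [r0 Mz0 dense]]]] := image_ball_somewhere_dense.
exists (4 * n%:R / r + 1) => [|z e Mz e0].
  by rewrite ltr_wpDl // divr_ge0 ?mulr_ge0 // ltW.
have [->|z_neq0] := eqVneq z 0.
  exists 0; first by rewrite !normr0 mulr0.
  by rewrite linear0 subrr normr0.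
have nz : 0 < `|z| by rewrite normr_gt0.
pose t := r / (2 * `|z|); have t0 : 0 < t by rewrite divr_gt0 ?mulr_gt0.
have et0 : 0 < e * t / 2 by rewrite divr_gt0 // mulr_gt0.
have Mz1 : range A (z0 + t *: z).
  have [[x _ <-] [y _ <-]] := (Mz0, Mz).
  by exists (x + t *: y) => //; rewrite linearD linearZ.
have [|x1 x1n zx1] := dense _ _ Mz1 _ et0.
  rewrite addrC addKr normrZ gtr0_norm // /t invfM mulrA mulfVK ?gt_eqF //.
  lra.
have [|x2 x2n zx2] := dense _ _ Mz0 _ et0; first by rewrite subrr normr0.
exists (t^-1 *: (x1 - x2)).
  rewrite normrZ gtr0_norm ?invr_gt0 // mulrDl mul1r.
  have -> : 4 * n%:R / r * `|z| = t^-1 * (2 * n%:R).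
    rewrite /t invfM invrK; field.
    by rewrite gt_eqF.
  rewrite (@le_trans _ _ (t^-1 * (2 * n%:R))) ?lerDl //.
  rewrite ler_pM2l ?invr_gt0 //; have := ler_normB x1 x2; lra.
rewrite linearZ linearB /=.
have -> : z - t^-1 *: (A x1 - A x2) =
    t^-1 *: ((z0 + t *: z - A x1) - (z0 - A x2)).
  rewrite opprB [z0 + _]addrC -!addrA [in RHS]scalerDr scalerA mulVf ?gt_eqF //.
  rewrite scale1r -scalerN; congr (_ + _ *: _); rewrite opprB.
  by rewrite addrCA [z0 + _]addrC subrK addrC.
rewrite normrZ gtr0_norm ?invr_gt0 // ltr_pdivrMl //.
rewrite (le_lt_trans (ler_normB _ _)) //; lra.
Qed.

Hypothesis completeV : fast_complete [set: V].
Hypothesis boundedA : exists C, forall x, `|A x| <= C * `|x|.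

(** Successive approximation: correcting the error of an approximate preimage
    halves it at each step, and the corrections form a geometric series. *)
Lemma open_onto_range :
  exists C, forall z, range A z -> exists2 x, A x = z & `|x| <= C * `|z|.
Proof.
have [C C0 almost] := almost_open; exists (2 * C) => z Mz.
have half (y : W) : exists x, range A y -> `|x| <= C * `|y| /\ `|y - A x| <= `|y| / 2.
  have [My|nMy] := pselect (range A y); last by exists 0.
  have [->|y_neq0] := eqVneq y 0.
    by exists 0 => _; rewrite linear0 subrr !normr0 mulr0 mul0r.
  have y2 : 0 < `|y| / 2 by rewrite divr_gt0 ?normr_gt0.
  by have [x xy yx] := almost _ _ My y2; exists x => _; split=> //; exact: ltW.
have [g gP] := choice half.
pose err n := iter n (fun y => y - A (g y)) z.
pose u n := \sum_(i < n) g (err i).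
have Merr n : range A (err n).
  elim: n => //= n [x _ <-].
  by exists (x - g (A x)) => //; rewrite linearB.
have Au n : A (u n) = z - err n.
  rewrite /u; elim: n => [|n IH]; first by rewrite big_ord0 linear0 subrr.
  by rewrite big_ord_recr linearD /= IH /= opprB -addrA [- _ + _]addrC.
have err_le n : `|err n| <= `|z| * 2 ^- n.
  elim: n => [|n IH]; first by rewrite expr0 invr1 mulr1.
  rewrite (le_trans (gP _ (Merr n)).2) // exprSr invfM mulrA.
  by rewrite ler_pM2r ?invr_gt0.
have [->|z_neq0] := eqVneq z 0.
  by exists 0; [exact: linear0 | rewrite !normr0 mulr0].
have c0 : 0 < C * `|z| by rewrite mulr_gt0 ?normr_gt0.
have [||l _ lu] := completeV (u := fun n => (C * `|z|)^-1 *: u n).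
- by [].
- move=> n; rewrite -scalerBr normrZ gtr0_norm ?invr_gt0 // ler_pdivrMl //.
  rewrite /u big_ord_recr /= addrAC subrr add0r (le_trans (gP _ (Merr n)).1) //.
  by rewrite -mulrA ler_pM2l.
exists ((C * `|z|) *: l).
  have [B AB] := boundedA; apply/eqP; rewrite -subr_eq0 -normr_le0.
  apply: (@le_pow2_le0 _ _ (`|B| * (C * `|z| * 2) + `|z|)) => n.
  have -> : A ((C * `|z|) *: l) - z =
      - (C * `|z|) *: A ((C * `|z|)^-1 *: u n - l) - err n.
    have zE : z = (C * `|z|) *: A ((C * `|z|)^-1 *: u n) + err n.
      by rewrite -[_ *: A _]linearZ /= scalerA divff ?gt_eqF // scale1r Au subrK.
    rewrite [X in _ - X = _]zE opprD addrA linearZ linearB /=.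
    by rewrite scaleNr scalerBr opprB.
  rewrite (le_trans (ler_normB _ _)) // mulrDl lerD //.
  set w := _ - l; have {}lu : `|w| <= 2 * 2 ^- n by exact: lu.
  have Aw : `|A w| <= `|B| * (2 * 2 ^- n).
    rewrite (le_trans (AB w)) // (@le_trans _ _ (`|B| * `|w|)) //.
      by rewrite ler_wpM2r // ler_norm.
    by rewrite ler_wpM2l.
  rewrite normrZ normrN (gtr0_norm c0).
  have -> : `|B| * (C * `|z| * 2) * 2 ^- n = C * `|z| * (`|B| * (2 * 2 ^- n)).
    by ring.
  by rewrite ler_pM2l.
have := lu 0%N; rewrite /u big_ord0 scaler0 sub0r normrN expr0 invr1 mulr1 => l2.
have -> : 2 * C * `|z| = C * `|z| * 2 by ring.
by rewrite normrZ gtr0_norm // ler_pM2l.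
Qed.
End RealOpenMapping.

Lemma real_open_mapping (R : realType) : open_mapping_property R.
Proof.
move=> V W A lA bA cV cA.
pose f : {linear V -> W} := HB.pack A (GRing.isLinear.Build _ _ _ _ _ lA).
have [C fC] := @open_onto_range R V W f cA cV bA; exists C => x.
by have [x' fx' x'C] := fC (f x) (ex_intro2 _ _ x I erefl); exists x'.
Qed.

(** * Restriction of scalars from the complexes to the reals *)

Local Open Scope complex_scope.

Section RealForm.
Variables (R : realType) (V : normedModType R[i]).

(** A complex normed space with scalars restricted to the reals.  The complex
    norm takes its values in the complex field, and is replaced by its real part. *)
Definition real_form : Type := V.

HB.instance Definition _ := GRing.Zmodule.on real_form.

Definition real_scale (a : R) (x : real_form) : real_form := a%:C *: (x : V).

Lemma real_scaleA a b x : real_scale a (real_scale b x) = real_scale (a * b) x.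
Proof. by rewrite /real_scale scalerA -rmorphM. Qed.

Lemma real_scale1 : left_id 1 real_scale.
Proof. by move=> x; rewrite /real_scale rmorph1 scale1r. Qed.

Lemma real_scaleDr : right_distributive real_scale +%R.
Proof. by move=> a x y; rewrite /real_scale scalerDr. Qed.

Lemma real_scaleDl x : {morph real_scale^~ x : a b / a + b}.
Proof. by move=> a b; rewrite /real_scale rmorphD scalerDl. Qed.

HB.instance Definition _ := GRing.Zmodule_isLmodule.Build R real_form
  real_scaleA real_scale1 real_scaleDr real_scaleDl.

Definition real_norm (x : real_form) : R := complex.Re `|x : V|.

Lemma real_normE x : (real_norm x)%:C = `|x : V|.
Proof. exact/RRe_real/normr_real. Qed.

Lemma real_normD x y : real_norm (x + y) <= real_norm x + real_norm y.
Proof. by rewrite -lecR rmorphD /= !real_normE ler_normD. Qed.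

Lemma real_normZ a x : real_norm (a *: x) = `|a| * real_norm x.
Proof.
apply: complexI; rewrite rmorphM /= !real_normE normrZ; congr (_ * _).
by rewrite normc_def /= expr0n addr0 sqrtr_sqr.
Qed.

Lemma real_norm0_eq0 x : real_norm x = 0 -> x = 0.
Proof.
move=> x0; have := real_normE x; rewrite x0 => /esym/eqP.
by rewrite normr_eq0 => /eqP.
Qed.

HB.instance Definition _ := Lmodule_isNormed.Build R real_form
  real_normD real_normZ real_norm0_eq0.

Lemma real_form_normE (x : real_form) : (`|x|)%:C = `|x : V|.
Proof. exact: real_normE. Qed.

(** The thresholds 2 ^- n are real, so both norms test the same sequences. *)
Lemma real_form_fast_complete (M : set V) :
  fast_complete M -> fast_complete (M : set real_form).
Proof.
move=> cM u Mu uS; have [|l Ml lu] := cM u Mu.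
  move=> n; rewrite -[2]/(1 + 1) -[1](rmorph1 (real_complex R)) -rmorphD.
  by rewrite -rmorphXn -fmorphV -real_form_normE lecR uS.
exists l => // n; have := lu n; rewrite -real_form_normE.
by rewrite -[2](rmorph_nat (real_complex R)) -rmorphXn -fmorphV -rmorphM lecR.
Qed.
End RealForm.

(** * Separation and open mappings over the complexes *)

Section ComplexScalars.
Variable R : realType.

Lemma norm_real_complex (a : R) : `|a%:C| = (`|a|)%:C.
Proof. by rewrite normc_def /= expr0n addr0 sqrtr_sqr. Qed.

Lemma complex_archimedean : archimedean_property R[i].
Proof.
move=> e e0; have eR : (complex.Re e)%:C = e by exact/RRe_real/gtr0_real.
have [|n ne] := @real_archimedean R (complex.Re e).
  by rewrite -ltcR eR rmorph0.
exists n; rewrite -eR -[2](rmorph_nat (real_complex R)) -rmorphXn -fmorphV.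
by rewrite ltcR.
Qed.

Section Complexify.
Variables (V : normedModType R[i]) (g : real_form V -> R).
Hypothesis lg : scalar g.

(** The complex-linear functional with real part [g]. *)
Definition complexify (x : V) : R[i] := (g x)%:C - 'i * (g ('i *: x))%:C.

Let gD x y : g (x + y) = g x + g y.
Proof. by have := lg 1 x y; rewrite scale1r mul1r. Qed.

Let g0 : g 0 = 0.
Proof. by have := gD 0 0; rewrite addr0; lra. Qed.

Let gZ (a : R) (x : V) : g (a%:C *: x) = a * g x.
Proof. by have := lg a x 0; rewrite !addr0 g0 addr0. Qed.

Let gN (x : V) : g (- x) = - g x.
Proof. by have := gD x (- x); rewrite subrr g0; lra. Qed.

Lemma complexify_scalar : scalar complexify.
Proof.
move=> a x y; rewrite /complexify scalerDr !gD !rmorphD /=.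
have -> : g (a *: x) = complex.Re a * g x + complex.Im a * g ('i *: x).
  by rewrite [a in LHS]complexE scalerDl gD gZ ['i * _]mulrC -scalerA gZ.
have -> : g ('i *: (a *: x)) = complex.Re a * g ('i *: x) - complex.Im a * g x.
  rewrite [a in LHS]complexE scalerDl scalerDr gD scalerA ['i * (complex.Re a)%:C]mulrC -scalerA gZ.
  by rewrite !scalerA mulrA -expr2 sqr_i mulN1r scaleNr gN gZ.
case: a => a b /=; apply/eqP; rewrite eq_complex /=; simpc.
by apply/andP; split; rewrite // [X in X - _]addrC.
Qed.

Lemma complexify_bounded (C : R) : (forall x, `|g x| <= C * `|x|) ->
  forall x, `|complexify x| <= (C + C)%:C * `|x|.
Proof.
move=> gC x; rewrite (le_trans (ler_normB _ _)) // rmorphD mulrDl normrM.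
have norm_i : `|'i : R[i]| = 1.
  by rewrite normc_def /= expr0n expr1n add0r sqrtr1.
have gCc (y : V) : `|(g y)%:C| <= C%:C * `|y|.
  by rewrite norm_real_complex -(real_form_normE (y : real_form V)) -rmorphM lecR gC.
by rewrite norm_i mul1r lerD // (le_trans (gCc _)) // normrZ norm_i mul1r.
Qed.
End Complexify.

(** Separate over the reals and complexify; a functional whose real part is 1 at
    [v] can be normalized to take the value 1 there. *)
Lemma complex_separation : separation_property R[i].
Proof.
move=> V M v d [M0 Mlin] d0 dM.
have dR : (complex.Re d)%:C = d by exact/RRe_real/gtr0_real.
have [||m Mm|g [lg [C gC] gM gv]] :=
    @real_separation R (real_form V) M v (complex.Re d).
- by split=> // a x y Mx My; exact: (Mlin a%:C).
- by rewrite -ltcR dR rmorph0.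
- by rewrite -lecR dR real_form_normE dM.
pose f := complexify g; have lf := complexify_scalar lg.
have fv0 : f v != 0 by rewrite eq_complex /f /complexify gv; simpc; rewrite oner_eq0.
exists (fun x => f x / f v); split=> [a x y||m Mm|].
- by rewrite /f lf mulrDl mulrA.
- exists ((C + C)%:C / `|f v|) => x.
  rewrite normrM normfV mulrAC ler_wpM2r ?invr_ge0 //.
  exact: complexify_bounded.
- have Mim : M ('i *: m) by rewrite -['i *: m]addr0; exact: Mlin.
  by have -> : f m = 0; rewrite ?mul0r // /f /complexify !gM // rmorph0 mulr0 subrr.
- by rewrite divff.
Qed.

(** Only real linearity matters, so the real theorem applies to the real forms. *)
Lemma complex_open_mapping : open_mapping_property R[i].
Proof.
move=> V W A lA [B AB] cV cA.
have AB' x : `|A x| <= (complex.Re B)%:C * `|x|.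
  have : 0 <= B * `|x| by exact: le_trans (AB x).
  have [->|x_neq0] := eqVneq x 0.
    by have := AB 0; rewrite normr0 !mulr0.
  rewrite pmulr_lge0 ?normr_gt0 // => /ger0_real/RRe_real ->; exact: AB.
have [a x y||||C AC] := @real_open_mapping R (real_form V) (real_form W) A.
- exact: (lA a%:C).
- exists (complex.Re B) => x.
  by rewrite -lecR rmorphM /= !real_form_normE AB'.
- exact: real_form_fast_complete.
- exact: (@real_form_fast_complete _ W (range A)).
exists C%:C => x; have [x' Ax' x'C] := AC x; exists x' => //.
by rewrite -!real_form_normE -rmorphM lecR.
Qed.
End ComplexScalars.

(** * Closed subspaces and bounded projections *)

Section BoundedOperatorTheory.
Variables (K : numFieldType) (V : normedModType K).
Implicit Types (M : set V) (T : 'L(V)).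

Lemma boundedOp_of (f : V -> V) : linear f ->
  (exists C, forall x, `|f x| <= C * `|x|) -> exists T, T =1 f.
Proof.
by move=> lf bf; exists (BoundedOp (asboolT (conj lf bf) : f \in @bounded_linear_pred K V)).
Qed.

Lemma rank_one_op (f : V -> K) w : scalar f ->
  (exists C, forall x, `|f x| <= C * `|x|) -> exists T, forall x, T x = f x *: w.
Proof.
move=> lf [C fC]; apply: (@boundedOp_of (fun x => f x *: w)) => [a x y|].
  by rewrite lf scalerDl scalerA.
by exists (C * `|w|) => x; rewrite normrZ mulrAC ler_wpM2r.
Qed.

Lemma op_bounded_gt0 T : exists2 C, 0 < C & forall x, `|T x| <= C * `|x|.
Proof.
have [C TC] := op_bounded T; exists (`|C| + 1) => [|x]; first by rewrite ltr_wpDl.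
have Cx : C * `|x| <= `|C| * `|x|.
  have : 0 <= C * `|x| by exact: le_trans (TC x).
  by move=> /ger0_norm <-; rewrite normrM normr_id.
by rewrite (le_trans (TC x)) // (le_trans Cx) // ler_wpM2r // lerDl.
Qed.

(** Reduces topological closedness to a statement about norms, which transfers
    directly between a range and the ambient space. *)
Lemma closed_distP M :
  closed M <-> forall v, ~ M v -> exists2 d, 0 < d & forall m, M m -> d <= `|v - m|.
Proof.
rewrite closedE; split=> [Mcl v nMv|Md v nv].
  have : \forall m \near v, ~ M m by apply: contrapT => /Mcl.
  move=> /nbhs_ballP[d /= d0 dM]; exists d => // m Mm.
  rewrite real_leNgt ?(gtr0_real d0) ?normr_real //; apply/negP => vm.
  by apply: (dM m) Mm; rewrite -ball_normE.
apply: contrapT => /Md[d d0 dM]; apply: nv; apply/nbhs_ballP; exists d => //= m.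
rewrite -ball_normE /= => vm /dM.
by rewrite real_leNgt ?(gtr0_real d0) ?normr_real // vm.
Qed.

Lemma closed_kernel T : closed [set x | T x = 0].
Proof.
apply/closed_distP => v /eqP Tv; have [C C0 TC] := op_bounded_gt0 T.
exists (`|T v| / C) => [|m Tm]; first by rewrite divr_gt0 ?normr_gt0.
by rewrite ler_pdivrMr // mulrC (le_trans _ (TC _)) // linearB /= Tm subr0.
Qed.

Lemma subspace_kernel T : subspace [set x | T x = 0].
Proof.
split=> [|a x y /= Tx Ty]; first exact: linear0.
by rewrite linearP /= Tx Ty scaler0 addr0.
Qed.

Lemma subspace_range T : subspace (range T).
Proof.
split=> [|a _ _ [x _ <-] [y _ <-]]; first by exists 0 => //; exact: linear0.
by exists (a *: x + y) => //; exact: linearP.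
Qed.

Lemma finite_rankE T : T \in @finite_rank K V <-> finite_dim (range T).
Proof. by split=> [/asboolP|?]; last exact/asboolP. Qed.
End BoundedOperatorTheory.

Section Projections.
Variables (K : numFieldType) (V : normedModType K).
Hypothesis sepK : separation_property K.
Implicit Types (M : set V) (T P E : 'L(V)).

(** Induction on a spanning sequence.  Given a projection [P] onto the part of [M]
    spanned by the tail and a vector [v] of [M] outside it, a functional that is 1
    on u = v - P v provides the missing coordinate on the range of [1 - P]. *)
Lemma finite_dim_projection M : subspace M -> finite_dim M ->
  exists P, (forall x, M (P x)) /\ (forall x, M x -> P x = x).
Proof.
move=> Msub [s Ms]; elim: s M Msub Ms => [|w s IH] M Msub Ms.
  exists 0; split=> x; first by case: Msub.
  by move=> /Ms/lin_span_nil ->.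
have [Mss|] := pselect (M `<=` lin_span s); first exact: IH.
move=> /existsNP[v /not_implyP[Mv nsv]].
have [M0 Mlin] := Msub.
have [||P [PM PE]] := IH (M `&` lin_span s).
- split=> [|a x y [Mx sx] [My sy]]; first by split=> //; exact: lin_span0.
  by split; [exact: Mlin | exact: lin_spanP].
- by move=> x [].
pose u := v - P v.
have Mu : M u by rewrite /u addrC -scaleN1r; apply: Mlin => //; case: (PM v).
have u_neq0 : 0 < `|u|.
  by rewrite normr_gt0 subr_eq0; apply: contra_notN nsv => /eqP ->; case: (PM v).
have sub0 : subspace [set (0 : V)].
  by split=> // a x y -> ->; rewrite scaler0 addr0.
have [|f [lf bf _ fu]] := sepK (v := u) sub0 u_neq0; first by move=> m ->; rewrite subr0.
have [F FE] := rank_one_op u lf bf.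
exists (P + F * (1 - P)); have QE x : (P + F * (1 - P)) x = P x + f (x - P x) *: u.
  by rewrite opDE opME FE.
split=> [x|x Mx].
  by rewrite QE addrC; apply: Mlin => //; case: (PM x).
have /lin_span_cons[c0 vc0] := Ms _ Mv; have /lin_span_cons[c xc] := Ms _ Mx.
have c0_neq0 : c0 != 0.
  by apply: contra_notN nsv => /eqP c00; move: vc0; rewrite c00 scale0r subr0.
pose y := x - (c / c0) *: v.
have xE : x = (c / c0) *: v + y by rewrite addrC subrK.
have My : M y by rewrite /y addrC -scaleNr; exact: Mlin.
have sy : lin_span s y.
  have -> : y = - (c / c0) *: (v - c0 *: w) + (x - c *: w).
    rewrite scalerBr scalerA mulNr mulfVK // !scaleNr opprK.
    by rewrite [RHS]addrACA subrr addr0 addrC.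
  exact: lin_spanP.
have Pv : (P + F * (1 - P)) v = v by rewrite QE fu scale1r addrC subrK.
have f0 : f 0 = 0.
  by have := lf (-1) 0 0; rewrite scaler0 addr0 mulN1r addNr.
have Py : (P + F * (1 - P)) y = y by rewrite QE PE // subrr f0 scale0r addr0.
by rewrite {1}xE linearP [RHS]xE -[in RHS]Pv -[in RHS]Py.
Qed.

(** The projection is improved by induction: its range is contained in the sum of
    [M] and the span of a sequence, which is shortened one vector at a time. *)
Lemma closed_finite_codim_projection M : subspace M -> closed M -> finite_codim M ->
  exists E, [/\ forall x, M (E x), forall x, M x -> E x = x &
    1 - E \in @finite_rank K V].
Proof.
move=> Msub Mcl [s0 s0M].
suff [E [EM EE]] : exists E, (forall x, M (E x)) /\ (forall x, M x -> E x = x).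
  exists E; split=> //; apply/finite_rankE.
  apply: finite_dimS (finite_dim_linear_image (op_linear (1 - E)) (finite_dim_span s0)).
  move=> _ [x _ <-]; have [u s0u /EE xu] := s0M x; exists u => //.
  have {}xu : E x - E u = x - u by rewrite -xu linearB.
  apply/eqP.
  by rewrite -[op_fun _ u]/(u - E u) -[op_fun _ x]/(x - E x) eq_sym subr_eq -addrA [- _ + _]addrC xu addrC subrK eqxx.
have [M0 Mlin] := Msub.
(* E is the identity on M and maps into the sum of M and the span of s. *)
suff H n : forall s E, size s = n -> (forall x, M x -> E x = x) ->
    (forall x, exists2 u, lin_span s u & M (E x - u)) ->
    exists E', (forall x, M (E' x)) /\ (forall x, M x -> E' x = x).
  by apply: (H _ s0 1 erefl) => // x; exact: s0M.
elim: n => [|n IH] s E sn EM Es.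
  exists E; split=> // x; have [u] := Es x.
  by rewrite (size0nil sn) => /lin_span_nil ->; rewrite subr0.
case: s sn Es => // v s [sn] Es; have [Mv|nMv] := pselect (M v).
  apply: (IH s E) => // x; have [u /lin_span_cons[c suc] Mxu] := Es x.
  exists (u - c *: v) => //; rewrite opprB addrC -addrA [- u + _]addrC.
  exact: Mlin.
have /closed_distP/(_ v nMv)[d d0 dM] := Mcl.
have [f [lf bf fM fv]] := sepK Msub d0 dM.
have [F FE] := rank_one_op v lf bf.
have fD x y : f (x + y) = f x + f y by have := lf 1 x y; rewrite scale1r mul1r.
(* 1 - F fixes M and kills v; it moves the remaining vectors of s into the
   kernel of f. *)
apply: (IH (map (1 - F) s) (E - F * E)); first by rewrite size_map.
  by move=> x Mx; rewrite opDE opNE opME EM // FE fM // scale0r subr0.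
move=> x; have [u /lin_span_cons[c suc] Mxu] := Es x.
exists ((1 - F) (u - c *: v)); first exact: lin_span_map.
have fEx : f (E x) = f u by rewrite -(subrK u (E x)) fD fM // add0r.
have -> // : (E - F * E) x - (1 - F) (u - c *: v) = E x - u.
rewrite !opDE !opNE op1E opME !FE fEx.
have -> : f (u - c *: v) = f u - c by rewrite addrC -scaleNr lf fv mulr1 addrC.
rewrite scalerBl; set a := f u *: v; set b := c *: v.
have -> : u - b - (a - b) = u - a by rewrite opprB addrA subrK.
by rewrite opprB addrA subrK.
Qed.
End Projections.

(** * Completeness, parametrices and closed ranges *)

Section Completeness.
Variables (K : numFieldType) (archK : archimedean_property K).

Lemma pow2_gt0 n : 0 < 2 ^- n :> K.
Proof. by rewrite invr_gt0 exprn_gt0. Qed.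

Lemma closed_fast_complete (V : normedModType K) (M : set V) :
  fast_complete [set: V] -> closed M -> fast_complete M.
Proof.
move=> cV /closed_distP Mcl u Mu uS; have [//|l _ ul] := cV u _ uS.
exists l => //; apply: contrapT => /Mcl[d d0 dM].
have [|n dn] := archK (e := d / 2); first by rewrite divr_gt0.
have lun : `|l - u n| < d.
  by rewrite distrC (le_lt_trans (ul n)) // mulrC -ltr_pdivlMr.
by have := lt_le_trans lun (dM _ (Mu n)); rewrite ltxx.
Qed.

Lemma banach_fast_complete (X : completeNormedModType K) : fast_complete [set: X].
Proof.
move=> u _ uS.
have dist n k : `|u (n + k)%N - u n| <= 2 * 2 ^- n - 2 * 2 ^- (n + k).
  elim: k => [|k IH]; first by rewrite addn0 !subrr normr0.
  rewrite addnS (le_trans (ler_distD (u (n + k)%N) _ _)) //.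
  rewrite (le_trans (lerD (uS _) IH)) //.
  have -> : 2 ^- (n + k) = 2 * 2 ^- (n + k).+1 :> K.
    by rewrite exprS invfM mulVKf ?pnatr_eq0.
  set a := 2 ^- (n + k).+1; set b := 2 ^- n.
  suff -> : 2 * a + (2 * b - 2 * (2 * a)) = 2 * b - 2 * a by [].
  by ring.
have dist2 n k : `|u (n + k)%N - u n| <= 2 * 2 ^- n.
  by rewrite (le_trans (dist n k)) // lerBlDr lerDl mulr_ge0 // ltW ?pow2_gt0.
have cu : cauchy (u @ \oo).
  apply/cauchy_exP => e e0; have [|n en] := archK (e := e / 2).
    by rewrite divr_gt0.
  exists (u n); exists n => // m /= nm; rewrite -ball_normE /= distrC.
  rewrite -(subnKC nm) (le_lt_trans (dist2 _ _)) // mulrC -ltr_pdivlMr //.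
have [l ul] : exists l : X, u @ \oo --> l by apply/cvg_ex; apply: cauchy_cvg; exact: cu.
exists l => // n; apply/ler_addgt0Pr => e e0.
move/cvgrPdist_lt : ul => /(_ e e0)[m _ lu].
have {}lu := lu (n + m)%N (leq_addl _ _); rewrite /= in lu.
rewrite (le_trans (ler_distD (u (n + m)%N) _ _)) // lerD //.
  by rewrite distrC.
by rewrite distrC ltW.
Qed.
End Completeness.

Section Parametrix.
Variables (K : numFieldType) (V : normedModType K).
Hypothesis sepK : separation_property K.
Hypothesis omK : open_mapping_property K.
Hypothesis archK : archimedean_property K.

(** On the complement of the kernel given by [1 - P], [A] is a bijection onto its
    closed range, with bounded inverse by the open mapping property.  Composing
    with a projection [E] onto the range gives [G] with G A = 1 - P and A G = E. *)
Lemma Fredholm_parametrix (A : 'L(V)) : fast_complete [set: V] -> Fredholm A ->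
  exists G : 'L(V), G * A - 1 \in @finite_rank K V /\ A * G - 1 \in @finite_rank K V.
Proof.
move=> cV [Acl kerA codimA].
have [P [PA PE]] := finite_dim_projection sepK (subspace_kernel A) kerA.
have [E [EA EE Efin]] :=
  closed_finite_codim_projection sepK (subspace_range A) Acl codimA.
have [C AC] := omK (op_linear A) (op_bounded A) cV
  (closed_fast_complete archK cV Acl).
have sol z : exists y, [/\ A y = E z, P y = 0 & exists2 x, y = x - P x & `|x| <= C * `|E z|].
  have [x0 _ x0z] := EA z; have [x xx0 xC] := AC x0; exists (x - P x).
  split; last by exists x => //; rewrite -x0z.
    by rewrite linearB /= xx0 x0z PA subr0.
  by rewrite linearB /= (PE (P x)) ?subrr.
have [g gP] := choice sol.
have inj y z : A y = A z -> P y = 0 -> P z = 0 -> y = z.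
  move=> Ayz Py Pz; apply/eqP; rewrite -subr_eq0.
  have <- : P (y - z) = y - z by apply: PE; rewrite /= linearB /= Ayz subrr.
  by rewrite linearB /= Py Pz subrr.
have [G GE] : exists G : 'L(V), G =1 g.
  apply: boundedOp_of => [a y z|].
    have [[[Ay Py _] [Az Pz _]] [Ayz Pyz _]] := (gP y, gP z, gP (a *: y + z)).
    apply: inj => //; first by rewrite Ayz !linearP /= Ay Az.
    by rewrite linearP /= Py Pz scaler0 addr0.
  have [p p0 Pp] := op_bounded_gt0 P; have [e e0 Ee] := op_bounded_gt0 E.
  exists ((1 + p) * (`|C| * e)) => z; have [_ _ [x -> xC]] := gP z.
  rewrite (le_trans (ler_normB _ _)) // -mulrA mulrDl mul1r.
  have xb : `|x| <= `|C| * e * `|z|.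
    rewrite (le_trans xC) // -mulrA.
    have : 0 <= C * `|E z| by exact: le_trans xC.
    move=> /ger0_norm <-; rewrite normrM normr_id ler_wpM2l //.
  rewrite lerD // (le_trans (Pp x)) // ler_pM2l //.
exists G; split; apply/finite_rankE.
  apply: finite_dimS kerA => _ [z _ <-].
  rewrite opDE opNE op1E opME GE /= linearB /=; have [-> _ _] := gP (A z).
  by rewrite EE ?subrr //; exists z.
move/finite_rankE: Efin; apply: finite_dimS => _ [z _ <-]; exists (- z) => //.
rewrite !opDE !opNE !op1E opME GE; have [-> _ _] := gP z.
by rewrite linearN /= opprK addrC.
Qed.

(** Let F = B D B - B and let [P] project onto the range of [F].  If
    (1 - P)(1 - B D) x = 0, then x - B D x is in the range of [F], which is contained
    in that of [B], so x is in the range of [B].  The converse holds because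
    (1 - B D) B = - F.  Hence the range of [B] is the kernel of a bounded operator. *)
Lemma regular_closed_range (B D : 'L(V)) :
  B * D * B - B \in @finite_rank K V -> closed (range B).
Proof.
move=> /finite_rankE Ffin; set F := B * D * B - B in Ffin.
have [P [PF PE]] := finite_dim_projection sepK (subspace_range F) Ffin.
have FE x : F x = B (D (B x)) - B x by [].
clearbody F.
have [Q QE] : exists Q : 'L(V), forall x, Q x = x - B (D x) - P (x - B (D x)).
  by exists ((1 - P) * (1 - B * D)).
suff -> : range B = [set x | Q x = 0] by exact: closed_kernel.
apply/seteqP; split=> [_ [x _ <-]|x] /=.
  rewrite QE PE ?subrr //; exists (- x) => //.
  by rewrite linearN /= FE opprB.
rewrite QE => /eqP; rewrite subr_eq0 => /eqP xE; have [y _ yE] := PF (x - B (D x)).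
have {}xE : x = B (D x) + F y by rewrite yE -xE addrC subrK.
exists (D x + (D (B y) - y)) => //; rewrite [RHS]xE FE.
by rewrite !linearD linearN.
Qed.
End Parametrix.

(** * Operators factoring through the range of a power *)

Section RangeRestriction.
Variables (K : numFieldType) (X : normedModType K) (T : 'L(X)) (n : nat).
Local Notation Y := (rangeSpace (T ^+ n)).
Local Notation A := (range_restr T n).
Implicit Types (H : 'L(Y)) (x : X) (y : Y).

Lemma range_val_linear : linear (@range_val K X (T ^+ n)).
Proof. by []. Qed.

Definition range_incl : {linear Y -> X} :=
  HB.pack (@range_val K X (T ^+ n)) (GRing.isLinear.Build _ _ _ _ _ range_val_linear).

Lemma range_val_inj : injective (@range_val K X (T ^+ n)).
Proof. exact: val_inj. Qed.

Lemma finite_dim_range_val (M : set X) :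
  finite_dim M -> finite_dim [set y : Y | M (range_val y)].
Proof.
apply: (@finite_dim_preimage _ _ _ range_incl).
by apply: finite_dimS (@finite_dim0 _ _) => y y0; exact: range_val_inj.
Qed.

Lemma into_range_subproof x : (T ^+ n) x \in range_pred (T ^+ n).
Proof. by apply/asboolP; exists x. Qed.

(** T ^+ n as a surjection of X onto its range. *)
Definition into_range x : Y := RangeSpace (into_range_subproof x).

Lemma into_range_surj y : exists x, y = into_range x.
Proof.
case: y => y yP; have /asboolP[x _ xy] := yP; exists x.
by apply: range_val_inj; rewrite /= xy.
Qed.

Lemma range_restrX k y : range_val ((A ^+ k) y) = (T ^+ k) (range_val y).
Proof.
elim: k y => [|k IH] y; first by rewrite !expr0.
by rewrite !exprS !opME /= IH.
Qed.

Lemma into_range_val y : into_range (range_val y) = (A ^+ n) y.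
Proof. by apply: range_val_inj; rewrite range_restrX. Qed.

Lemma into_range_op x : into_range (T x) = A (into_range x).
Proof. by apply: range_val_inj; rewrite /= -!opME -exprS -exprSr. Qed.

Lemma lift_subproof H : exists L : 'L(X), forall x, L x = range_val (H (into_range x)).
Proof.
apply: (@boundedOp_of _ _ (fun x => range_val (H (into_range x)))) => [a x y|].
  have -> : into_range (a *: x + y) = a *: into_range x + into_range y.
    by apply: range_val_inj; exact: linearP.
  by rewrite linearP.
have [C C0 HC] := op_bounded_gt0 H; have [B B0 TB] := op_bounded_gt0 (T ^+ n).
exists (C * B) => x; rewrite (le_trans (HC _)) // -mulrA ler_pM2l //.
exact: TB.
Qed.

(** The operator on X that factors through the range of T ^+ n as
    X --T^n--> Y --H--> Y, followed by the inclusion. *)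
Definition lift_op H : 'L(X) := projT1 (cid (lift_subproof H)).

Lemma liftE H x : lift_op H x = range_val (H (into_range x)).
Proof. exact: (projT2 (cid (lift_subproof H))). Qed.

Lemma lift_finite_rank H : H \in @finite_rank K Y -> lift_op H \in @finite_rank K X.
Proof.
move=> /finite_rankE Hfin; apply/finite_rankE.
apply: finite_dimS (finite_dim_linear_image range_val_linear Hfin).
by move=> _ [x _ <-]; rewrite liftE; exists (H (into_range x)) => //; exists (into_range x).
Qed.

Lemma lift_congr H H' :
  calkin0_pi H = calkin0_pi H' -> calkin0_pi (lift_op H) = calkin0_pi (lift_op H').
Proof.
move=> /calkin0_piP HH'; apply/calkin0_piP.
have -> : lift_op H - lift_op H' = lift_op (H - H') by apply: op_ext => x; rewrite opDE opNE !liftE.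
exact: lift_finite_rank.
Qed.

(** The inclusion followed by T ^+ n is the n-th power of the restriction, which is
    why that power appears between [H] and [H']. *)
Lemma liftM H H' : lift_op H * lift_op H' = lift_op (H * A ^+ n * H').
Proof. by apply: op_ext => x; rewrite opME !liftE into_range_val !opME. Qed.

Lemma mul_lift H : T * lift_op H = lift_op (A * H).
Proof. by apply: op_ext => x; rewrite opME !liftE opME. Qed.

Lemma lift_mul H : lift_op H * T = lift_op (H * A).
Proof. by apply: op_ext => x; rewrite opME !liftE opME into_range_op. Qed.

Lemma lift1 : lift_op 1 = T ^+ n.
Proof. by apply: op_ext => x; rewrite liftE. Qed.

Lemma fast_complete_range : fast_complete (range (T ^+ n)) -> fast_complete [set: Y].
Proof.
move=> cR u _ uS; have [k|k|_ [x _ <-] lu] := cR (fun k => range_val (u k)).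
- by case: (u k) => y yP; exact/asboolP.
- exact: uS.
- by exists (into_range x).
Qed.

Lemma range_restr_range y : range A y <-> range (T ^+ n.+1) (range_val y).
Proof.
split=> [[z _ <-]|[x _ Tx]].
  by have [x ->] := into_range_surj z; exists x => //; rewrite exprS.
exists (into_range x) => //; apply: range_val_inj.
by rewrite -Tx exprS.
Qed.
End RangeRestriction.

(** * B-Fredholm operators and Drazin invertibility *)

Section BFredholmDrazin.
Variables (K : numFieldType) (X : completeNormedModType K) (T : 'L(X)).
Hypothesis sepK : separation_property K.
Hypothesis omK : open_mapping_property K.
Hypothesis archK : archimedean_property K.

(** Let [G] be a parametrix of the restriction A = T_[n].  The lift of G^(n + 1) is,
    modulo finite rank, a Drazin inverse of [T]: its products with [T] on either
    side are the lift of G^n, and T^(n + 1) times it is the lift of 1, which is T^n. *)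
Lemma B_Fredholm_Drazin : B_Fredholm T ->
  left_Drazin_invertible (calkin0_pi T) /\ right_Drazin_invertible (calkin0_pi T).
Proof.
move=> [n cl_n Tn_fred].
have cX : fast_complete [set: X] := @banach_fast_complete K archK X.
have cY := fast_complete_range (closed_fast_complete archK cX cl_n).
have [G [GA AG]] := Fredholm_parametrix sepK omK archK cY Tn_fred.
set A := range_restr T n in GA AG.
pose g := calkin0_pi G; pose a := calkin0_pi A.
have ga : g * a = 1 by rewrite -rmorphM -(rmorph1 (@calkin0_pi _ _)); apply/calkin0_piP.
have ag : a * g = 1 by rewrite -rmorphM -(rmorph1 (@calkin0_pi _ _)); apply/calkin0_piP.
pose phi H := calkin0_pi (lift_op (T := T) (n := n) H).
have phiE H H' : calkin0_pi H = calkin0_pi H' -> phi H = phi H' by exact: lift_congr.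
have piX k : calkin0_pi (T ^+ k) = calkin0_pi T ^+ k by exact: rmorphXn.
have ts : calkin0_pi T * phi (G ^+ n.+1) = phi (G ^+ n).
  rewrite /phi -rmorphM mul_lift; apply: lift_congr.
  by rewrite rmorphM !rmorphXn -/a -/g exprS mulrA ag mul1r.
have st : phi (G ^+ n.+1) * calkin0_pi T = phi (G ^+ n).
  rewrite /phi -rmorphM lift_mul; apply: lift_congr.
  by rewrite rmorphM !rmorphXn -/a -/g exprSr -mulrA ga mulr1.
apply: (@Drazin_inverse_invertible _ _ (phi (G ^+ n.+1)) n).
- by rewrite ts st.
- rewrite st /phi -rmorphM liftM; apply: lift_congr.
  by rewrite !rmorphM !rmorphXn -/a -/g expr_linv // mul1r.
- have tn : calkin0_pi T ^+ n = phi 1 by rewrite /phi lift1 piX.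
  rewrite exprSr -mulrA ts tn /phi -rmorphM liftM.
  by apply: lift_congr; rewrite !rmorphM !rmorphXn -/a -/g rmorph1 mul1r expr_linv.
Qed.

(** For large j, T^j is regular modulo finite rank, hence has closed range.  Modulo
    finite rank T^N also lies in L(X) T^(N + 1), which makes the kernel of T_[N]
    finite-dimensional, and in T^(N + 1) L(X), which makes its range of finite
    codimension. *)
Lemma Drazin_B_Fredholm :
  left_Drazin_invertible (calkin0_pi T) -> right_Drazin_invertible (calkin0_pi T) ->
  B_Fredholm T.
Proof.
move=> /left_Drazin_regular[b [k bk]] /right_Drazin_regular[c [l cl]].
rewrite -(calkin0_reprK b) in bk; rewrite -(calkin0_reprK c) in cl.
set S := calkin0_repr b in bk; set U := calkin0_repr c in cl.
have {}bk i j : (k <= j)%N -> T ^+ j * S ^+ i * T ^+ i - T ^+ j \in @finite_rank K X.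
  by move=> kj; apply/calkin0_piP; rewrite !rmorphM !rmorphXn bk.
have {}cl i j : (l <= j)%N -> T ^+ i * U ^+ i * T ^+ j - T ^+ j \in @finite_rank K X.
  by move=> lj; apply/calkin0_piP; rewrite !rmorphM !rmorphXn cl.
pose N := maxn k l; have [kN lN] : (k <= N)%N /\ (l <= N)%N.
  by rewrite leq_maxl leq_maxr.
have clT j : (k <= j)%N -> closed (range (T ^+ j)).
  by move=> kj; exact: (regular_closed_range sepK (bk j j kj)).
have opN (F : 'L(X)) v : F (- v) = - F v by exact: linearN.
have op0 (F : 'L(X)) : F 0 = 0 by exact: linear0.
exists N; first exact: clT.
split.
- apply/closed_distP => y; rewrite range_restr_range => nRy.
  have /closed_distP/(_ _ nRy)[d d0 dR] := clT N.+1 (leqW kN).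
  by exists d => // m /range_restr_range; exact: dR.
- have /finite_rankE/(@finite_dim_range_val _ _ T N _) := bk N.+1 N kN.
  apply: finite_dimS => y /= Ay0; have [x yx] := into_range_surj y.
  exists (- x) => //.
  have Tx0 : (T ^+ N.+1) x = 0.
    by move: Ay0 => /(congr1 (@range_val _ _ _)); rewrite yx /= exprS.
  rewrite -[LHS]/((T ^+ N) ((S ^+ N.+1) ((T ^+ N.+1) (- x))) - (T ^+ N) (- x)).
  by rewrite !opN Tx0 !op0 oppr0 sub0r opprK yx.
- have /finite_rankE/(@finite_dim_range_val _ _ T N _)[s sF] := cl N.+1 N lN.
  exists s => y; have [x yx] := into_range_surj y.
  pose z := into_range T N ((U ^+ N.+1) ((T ^+ N) x)).
  exists (y - range_restr T N z); last by exists z => //; rewrite opprB addrC subrK.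
  apply: sF; exists (- x) => //.
  pose W := T ^+ N.+1 * U ^+ N.+1 * T ^+ N.
  have WE : range_val (range_restr T N z) = W x by rewrite /= -opME -exprS.
  rewrite -[LHS]/(W (- x) - (T ^+ N) (- x)) !opN opprK addrC.
  by rewrite -[RHS]/(range_val y - range_val (range_restr T N z)) WE yx.
Qed.
Lemma B_Fredholm_iff_Drazin : B_Fredholm T <->
  left_Drazin_invertible (calkin0_pi T) /\ right_Drazin_invertible (calkin0_pi T).
Proof. by split=> [|[]]; [exact: B_Fredholm_Drazin | exact: Drazin_B_Fredholm]. Qed.
End BFredholmDrazin.

(* The scalar field is either the reals or the complexes. *)
Theorem mainTheorem3 (R : realType) :
  (forall (X : completeNormedModType R) (T : 'L(X)),
     B_Fredholm T <->
     left_Drazin_invertible (calkin0_pi T) /\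
     right_Drazin_invertible (calkin0_pi T)) /\
  (forall (X : completeNormedModType R[i]) (T : 'L(X)),
     B_Fredholm T <->
     left_Drazin_invertible (calkin0_pi T) /\
     right_Drazin_invertible (calkin0_pi T)).
Proof.
split=> X T; apply: B_Fredholm_iff_Drazin.
- exact: real_separation.
- exact: real_open_mapping.
- exact: real_archimedean.
- exact: complex_separation.
- exact: complex_open_mapping.
- exact: complex_archimedean.
Qed.
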